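(* For every $m\ge3$ and $\omega\in\Omega$, there is an algebra isomorphism $$\mathbb A^{\delta_\omega}(G_2(m))\ \cong\ \mathbb U\oplus\mathbb A^{\mathbf 1}(G_2(m-1)),\qquad \mathbb U=K^{\Omega\setminus\{\omega\}},$$ under which the summands $\mathbb U$ and $\mathbb A^{\mathbf 1}(G_2(m-1))$ are respectively the odd part and the even part of the $\mathbb Z_2$-grading of $\mathbb A^{\delta_\omega}(G_2(m))$ attached to $\tau=\{\omega\}$; here the right-hand side carries the product of $\mathbb M(\mathbb U)=\mathbb U\oplus\operatorname{Sym}_0(\mathbb U)$ under the identification $\operatorname{Sym}_0(\mathbb U)\cong\mathbb A^{\mathbf 1}(G_2(m-1))$, $S_{ij}\leftrightarrow e_{ij}$, so that $\mathbb U$ is the natural module for the even part, an even element $X$ acting on $x\in\mathbb U$ by $X\diamond x=-Xx$.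
   Context: $K$ is a formally real Pythagorean field, $\Omega=\{1,\dots,m\}$. For a finite set $T$ (with $|T|\geq2$), the Grassmannian geometry on $T$ has points the $2$-subsets $ij=\{i,j\}$ of $T$ and blocks $b_{ijk}=\{ij,ik,jk\}$ for $3$-subsets $\{i,j,k\}$ of $T$; $\operatorname{supp}(b_{ijk})=\{i,j,k\}$. $G_2(m)$ is this geometry on $\Omega$, and $G_2(m-1)$ is realized on $\Omega\setminus\{\omega\}$. For a decoration $\delta$ (map from blocks to $\{\pm1\}$), $\mathbb A^\delta$ is the commutative $K$-algebra with basis $\{e_p: p\text{ a point}\}$ and product $e_{ij}\circ_\delta e_{ik}=\delta(b_{ijk})e_{jk}$ for distinct $i,j,k$, and $e_p\circ_\delta e_q=0$ if $p=q$ or $p\cap q=\varnothing$. $\mathbf 1$ is the trivial decoration (all signs $+1$). The star decoration at $\omega$ is $\delta_\omega(b)=-1$ if $\omega\in\operatorname{supp}(b)$ and $\delta_\omega(b)=1$ otherwise. For $\tau\subseteq\Omega$, the associated $\mathbb Z_2$-grading of $\mathbb A^\delta(G_2(m))$ has even part $\operatorname{span}\{e_p:|p\cap\tau|\text{ even}\}$ and odd part $\operatorname{span}\{e_p:|p\cap\tau|\text{ odd}\}$. Matrix model: $\mathbb U=K^{\Omega\setminus\{\omega\}}$ is regarded as a Euclidean space with orthonormal basis $(v_i)_{i\in\Omega\setminus\{\omega\}}$; $xy^T$ is the endomorphism $z\mapsto\langle y,z\rangle x$; $S_{ij}=v_iv_j^T+v_jv_i^T$ ($i\ne j$); $\operatorname{Sym}_0(\mathbb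 U)=\operatorname{span}\{S_{ij}\}$ (symmetric, zero diagonal); $\pi$ is the projection of the symmetric endomorphisms onto $\operatorname{Sym}_0(\mathbb U)$ along $\operatorname{span}\{v_iv_i^T\}$. $\mathbb M(\mathbb U)$ is the commutative algebra on $\mathbb U\oplus\operatorname{Sym}_0(\mathbb U)$ with product $(x,X)\diamond(y,Y)=(-Xy-Yx,\ \pi(XY+YX-xy^T-yx^T))$. *)

(* Defs.v *)
From HB Require Import structures.
From mathcomp Require Import all_boot all_order all_algebra.

Set Implicit Arguments.
Unset Strict Implicit.
Unset Printing Implicit Defensive.

Import GRing.Theory.
Local Open Scope ring_scope.

Definition formally_real (K : fieldType) : Prop :=
  forall s : seq K, \sum_(x <- s) x ^+ 2 <> -1.

Definition pythagorean (K : fieldType) : Prop :=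
  forall s : seq K, exists z : K, \sum_(x <- s) x ^+ 2 = z ^+ 2.

(* The coordinate space K^I; [K^o] is K as a vector space over itself. *)
Notation coordspace K I := {ffun I -> K^o}.

Definition basis_vec (K : fieldType) (I : finType) (i : I) : coordspace K I :=
  [ffun j => (j == i)%:R].
Arguments basis_vec K {I} i.

Section Grassmannian.
Variable T : finType.

Definition point := {p : {set T} | #|p| == 2%N}.

Lemma pair_subproof (i j : T) : i != j -> #|[set i; j]| == 2%N.
Proof. by move=> ij; rewrite cards2 ij. Qed.

Definition pt (i j : T) (ij : i != j) : point :=
  exist _ [set i; j] (pair_subproof ij).

Definition triple :=
  {t : T * T * T | [&& t.1.1 != t.1.2, t.1.1 != t.2 & t.1.2 != t.2]}.

Lemma triple_neq12 (t : triple) : (val t).1.1 != (val t).1.2.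
Proof. by have /and3P[] := valP t. Qed.

Lemma triple_neq13 (t : triple) : (val t).1.1 != (val t).2.
Proof. by have /and3P[] := valP t. Qed.

Lemma triple_neq23 (t : triple) : (val t).1.2 != (val t).2.
Proof. by have /and3P[] := valP t. Qed.

Definition pt12 (t : triple) : point := pt (triple_neq12 t).
Definition pt13 (t : triple) : point := pt (triple_neq13 t).
Definition pt23 (t : triple) : point := pt (triple_neq23 t).

Definition is_block (b : {set point}) : bool :=
  [exists t : triple, b == [set pt12 t; pt13 t; pt23 t]].

Definition block := {b : {set point} | is_block b}.

Lemma triple_block_subproof (t : triple) :
  is_block [set pt12 t; pt13 t; pt23 t].
Proof. by apply/existsP; exists t. Qed.

Definition triple_block (t : triple) : block :=
  exist _ [set pt12 t; pt13 t; pt23 t] (triple_block_subproof t).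

Definition supp (b : block) : {set T} := \bigcup_(p in val b) val p.

Lemma supp_triple_block (t : triple) :
  supp (triple_block t) = [set (val t).1.1; (val t).1.2; (val t).2].
Proof.
apply/setP=> x; apply/bigcupP/idP => [[p]|] /=.
  by rewrite !inE -orbA => /or3P[] /eqP-> /=; rewrite !inE => /orP[]->;
     rewrite ?orbT.
rewrite !inE -orbA => /or3P[] /eqP->.
- by exists (pt12 t); rewrite !inE eqxx.
- by exists (pt12 t); rewrite !inE eqxx ?orbT.
by exists (pt13 t); rewrite !inE eqxx ?orbT.
Qed.

(* Signs are encoded by booleans: [d b] stands for the sign (-1) ^+ d b. *)
Definition decoration := block -> bool.

Definition trivial_decoration : decoration := fun _ => false.

Definition star_decoration (w : T) : decoration := fun b => w \in supp b.

End Grassmannian.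

(* Carrier of the algebra A^d of the Grassmannian geometry on T. *)
Notation galg K T := {ffun point T -> K^o}.

Section GrassmannianAlgebra.
Variables (K : fieldType) (T : finType).

(* Points p = ij and q = ik with i, j, k distinct determine (i, j, k), so the
   sum has at most one term; it is empty if p = q or p and q are disjoint. *)
Definition basis_prod (d : decoration T) (p q : point T) : galg K T :=
  \sum_(t : triple T | (p == pt12 t) && (q == pt13 t))
     (-1) ^+ d (triple_block t) *: basis_vec K (pt23 t).

Definition gprod (d : decoration T) (x y : galg K T) : galg K T :=
  \sum_p \sum_q (x p * y q : K) *: basis_prod d p q.

Lemma gprod_basis (d : decoration T) (p q : point T) :
  gprod d (basis_vec K p) (basis_vec K q) = basis_prod d p q.
Proof.
rewrite /gprod (bigD1 p) //= [X in _ + X]big1 ?addr0 => [|p' p'p]; last first.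
  by rewrite big1 // => q' _; rewrite ffunE (negPf p'p) mul0r scale0r.
rewrite (bigD1 q) //= [X in _ + X]big1 ?addr0 => [|q' q'q].
  by rewrite !ffunE !eqxx mul1r scale1r.
by rewrite [X in _ * X]ffunE (negPf q'q) mulr0 scale0r.
Qed.

Lemma gprod_triple (d : decoration T) (t : triple T) :
  gprod d (basis_vec K (pt12 t)) (basis_vec K (pt13 t)) =
  (-1) ^+ d (triple_block t) *: basis_vec K (pt23 t).
Proof.
rewrite gprod_basis /basis_prod (big_pred1 t) // => s.
apply/idP/eqP => [/andP[]|->]; last by rewrite !eqxx.
move=> /eqP /(congr1 val) /= e12 /eqP /(congr1 val) /= e13.
apply: val_inj; move: e12 e13.
case: t s => [[[i j] k] /= /and3P[ij ik jk]] [[[a b] c] /= /and3P[ab ac bc]].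
move=> e f.
have e1 : i \in [set a; b] by rewrite -e !inE eqxx.
have e2 : j \in [set a; b] by rewrite -e !inE eqxx orbT.
have f1 : i \in [set a; c] by rewrite -f !inE eqxx.
have f2 : k \in [set a; c] by rewrite -f !inE eqxx orbT.
rewrite !inE in e1 e2 f1 f2.
have ia : i = a.
  apply/eqP; apply: contraT => nia; move: e1 f1; rewrite (negPf nia) /=.
  by move=> /eqP ib /eqP ic; rewrite -ib -ic eqxx in bc.
subst a; move: e2 f2; rewrite ![_ == i]eq_sym (negPf ij) (negPf ik) /=.
by move=> /eqP-> /eqP->.
Qed.

Lemma gprod_same (d : decoration T) (p : point T) :
  gprod d (basis_vec K p) (basis_vec K p) = 0.
Proof.
rewrite gprod_basis /basis_prod big_pred0 // => t.
apply/andP=> -[/eqP-> /eqP /(congr1 val) /= e].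
have : (val t).1.2 \in [set (val t).1.1; (val t).2].
  by rewrite -e !inE eqxx orbT.
by rewrite !inE eq_sym (negPf (triple_neq12 t)) (negPf (triple_neq23 t)).
Qed.

Lemma gprod_disjoint (d : decoration T) (p q : point T) :
  val p :&: val q = set0 -> gprod d (basis_vec K p) (basis_vec K q) = 0.
Proof.
move=> pq; rewrite gprod_basis /basis_prod big_pred0 // => t.
apply/andP=> -[/eqP ep /eqP eq].
have : (val t).1.1 \in val p :&: val q by rewrite ep eq !inE !eqxx.
by rewrite pq inE.
Qed.

Definition even_part (tau : {set T}) : {vspace galg K T} :=
  <<[seq basis_vec K p |
       p in [pred p : point T | ~~ odd #|(val p :&: tau)%SET|]]>>%VS.

Definition odd_part (tau : {set T}) : {vspace galg K T} :=
  <<[seq basis_vec K p |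
       p in [pred p : point T | odd #|(val p :&: tau)%SET|]]>>%VS.

End GrassmannianAlgebra.
Arguments even_part K {T} tau.
Arguments odd_part K {T} tau.

Section MatrixModel.
Variables (K : fieldType) (I : finType).
Notation U := (coordspace K I).

Definition dotprod (x y : U) : K := \sum_i x i * y i.

Definition rank1_fun (x y : U) : U -> U := fun z => dotprod y z *: x.

Fact rank1_fun_is_linear (x y : U) : linear (rank1_fun x y).
Proof.
move=> a u v; rewrite /rank1_fun scalerA -scalerDl; congr (_ *: _).
rewrite /dotprod mulr_sumr -big_split /=; apply: eq_bigr => i _.
by rewrite !ffunE mulrDr; congr (_ + _); rewrite [LHS]mulrCA.
Qed.

HB.instance Definition _ (x y : U) :=
  GRing.isLinear.Build K U U *:%R (rank1_fun x y) (rank1_fun_is_linear x y).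

(* The endomorphism x y^T. *)
Definition rank1 (x y : U) : 'End(U) := linfun (rank1_fun x y).

Definition symS (i j : I) : 'End(U) :=
  rank1 (basis_vec K i) (basis_vec K j) +
  rank1 (basis_vec K j) (basis_vec K i).

Definition Sym0 : {vspace 'End(U)} :=
  <<[seq symS ij.1 ij.2 | ij in [pred ij : I * I | ij.1 != ij.2]]>>%VS.

Definition Diag : {vspace 'End(U)} :=
  <<[seq rank1 (basis_vec K i) (basis_vec K i) | i : I]>>%VS.

Lemma rank1_basis (i j k l : I) :
  rank1 (basis_vec K i) (basis_vec K j) (basis_vec K k) l =
  (j == k)%:R * (l == i)%:R :> K.
Proof.
rewrite lfunE /= /rank1_fun !ffunE /=; congr (_ * _).
rewrite /dotprod (bigD1 j) //= big1 => [|h hj].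
  by rewrite !ffunE eqxx mul1r addr0.
by rewrite !ffunE (negPf hj) mul0r.
Qed.

Lemma span_coord0 (s : seq 'End(U)) (k l : I) (X : 'End(U)) :
    (forall Y, Y \in s -> Y (basis_vec K k) l = 0) ->
  X \in <<s>>%VS -> X (basis_vec K k) l = 0.
Proof.
move=> s0 Xs; rewrite (coord_span (X := in_tuple s) Xs) sum_lfunE sum_ffunE.
apply: big1 => i _; rewrite scale_lfunE ffunE s0 ?scaler0 //.
by rewrite mem_nth.
Qed.

Lemma Sym0_Diag_disjoint : (Sym0 :&: Diag = 0)%VS.
Proof.
apply/eqP; rewrite -subv0; apply/subvP=> X /memv_capP[XS XD]; rewrite memv0.
have X0 k l : X (basis_vec K k) l = 0.
  have [<-|kl] := eqVneq k l.
    apply: span_coord0 XS => _ /imageP[[i j] /= ij ->].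
    rewrite add_lfunE ffunE !rank1_basis.
    rewrite ![_ == k]eq_sym; have [->|_] := eqVneq k i.
      by rewrite (negPf ij) mul0r mulr0 addr0.
    by rewrite mulr0 mul0r addr0.
  apply: span_coord0 XD => _ /imageP[i _ ->]; rewrite rank1_basis.
  have [->|_] := eqVneq i k; last by rewrite mul0r.
  by rewrite eq_sym (negPf kl) mulr0.
apply/eqP/lfunP=> x; rewrite zero_lfunE.
have -> : x = \sum_k (x k : K) *: basis_vec K k.
  apply/ffunP=> l; rewrite sum_ffunE (bigD1 l) //= big1 => [|k kl].
    by rewrite !ffunE eqxx addr0 [RHS]mulr1.
  by rewrite !ffunE eq_sym (negPf kl) [LHS]mulr0.
rewrite linear_sum big1 // => k _; rewrite linearZ /=.
by apply/ffunP=> l; rewrite !ffunE X0 [LHS]mulr0.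
Qed.

(* The projection onto Sym0 along Diag; only its values on Sym0 + Diag, the
   space of symmetric endomorphisms, are meaningful. *)
Definition sym_proj : 'End(U) -> 'End(U) := daddv_pi Sym0 Diag.

Definition to_Sym0 (Z : 'End(U)) : subvs_of Sym0 :=
  Subvs (memv_pi Sym0 Diag Z : sym_proj Z \in Sym0).

Definition mprod (u v : U * subvs_of Sym0) : U * subvs_of Sym0 :=
  let: (x, X) := u in
  let: (y, Y) := v in
  (- vsval X y - vsval Y x,
   to_Sym0 ((vsval X \o vsval Y)%VF + (vsval Y \o vsval X)%VF
            - rank1 x y - rank1 y x)).

(* The product of M(U), carried over to U (+) A^1 along a linear
   identification sigma of A^1 with Sym_0(U). *)
Definition transported_mprod (sigma : 'Hom(galg K I, subvs_of Sym0))
    (u v : U * galg K I) : U * galg K I :=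
  let w := mprod (u.1, sigma u.2) (v.1, sigma v.2) in
  (w.1, (sigma^-1)%VF w.2).

End MatrixModel.
Arguments symS K {I} i j.

Definition algebra_iso (K : fieldType) (A B : vectType K)
    (mulA : A -> A -> A) (mulB : B -> B -> B) (f : 'Hom(A, B)) : Prop :=
  bijective f /\ forall x y : A, f (mulA x y) = mulB (f x) (f y).

Notation punctured w := {i | i != w}.

(* Main.v *)
(* Extending [a p] by 0 to sets [p] of size other than 2, an element of the
   Grassmannian algebra becomes a symmetric matrix with zero diagonal, and
   the product of A^1 becomes the off-diagonal part of XY + YX.  Splitting
   off the row of w, an element of the star-decorated algebra is a vector x
   together with such a matrix X on the remaining indices.  The (j, w)
   entries of a product form the vector -Xy - Yx; in the (j, k) entries with
   j, k != w, the term with middle index w contributes the off-diagonal part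
   of -xy^T - yx^T. *)
From HB Require Import structures.
Require Import Defs.
From mathcomp Require Import all_boot all_order all_algebra ring.
Import GRing.Theory.
Local Open Scope ring_scope.

Set Implicit Arguments.
Unset Strict Implicit.
Unset Printing Implicit Defensive.

(** * Coefficients indexed by sets, and an entry formula for the product *)

Section Coordinates.
Variables (K : fieldType) (T : finType).
Implicit Types (a b : galg K T) (i j k : T).

(* Zero if [A] does not have exactly two elements. *)
Definition coef a (A : {set T}) : K :=
  oapp (a : point T -> K) 0 (insub A : option (point T)).

Lemma coef_val a (p : point T) : coef a (val p) = a p.
Proof. by rewrite /coef valK. Qed.

Lemma coef_pt a i j (ij : i != j) : coef a [set i; j] = a (pt ij).
Proof. exact: (coef_val a (pt ij)). Qed.

Lemma coef_diag a i : coef a [set i; i] = 0.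
Proof. by rewrite /coef insubN // setUid cards1. Qed.

Lemma coef_lin c a b (A : {set T}) :
  coef (c *: a + b) A = c * coef a A + coef b A.
Proof.
rewrite /coef; case: insub => [p|] /=; last by rewrite mulr0 addr0.
by rewrite !ffunE.
Qed.

Lemma coefC a i j : coef a [set i; j] = coef a [set j; i].
Proof. by rewrite setUC. Qed.

Lemma pointP (p : point T) : exists i j (ij : i != j), p = pt ij.
Proof.
have /cards2P[i [j [ij e]]] := valP p.
by exists i, j, ij; apply: val_inj.
Qed.

Lemma coef_inj a b :
  (forall i j, i != j -> coef a [set i; j] = coef b [set i; j]) -> a = b.
Proof.
move=> ab; apply/ffunP=> p; have [i [j [ij ->]]] := pointP p.
by rewrite -!coef_pt ab.
Qed.

Lemma coef_basis i j k l (ij : i != j) :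
  coef (basis_vec K (pt ij)) [set k; l] = ([set k; l] == [set i; j])%:R.
Proof.
have [->|kl] := eqVneq k l.
  rewrite coef_diag; case: eqP => // /(congr1 (fun A : {set T} => #|A|)).
  by rewrite setUid cards1 cards2 ij.
by rewrite coef_pt ffunE.
Qed.

(** Both [i] and [j] must occur among [k] and [l], which leaves the two matchings. The case [k = l]
    is included: both sides are then false. *)
Lemma eq_set2 i j k l : i != j ->
  ([set k; l] == [set i; j]) = ((k == i) && (l == j)) || ((k == j) && (l == i)).
Proof.
move=> ij; apply/eqP/idP => [e|/orP[]/andP[/eqP-> /eqP->] //];
  last exact: setUC.
have : i \in [set k; l] by rewrite e set21.
have : j \in [set k; l] by rewrite e set22.
rewrite !inE !(eq_sym _ k) !(eq_sym _ l).
case: (eqVneq k i) => [->|_] /= kl.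
  by move: kl; rewrite (negPf ij) /= => ->.
by move/eqP=> li; move: kl; rewrite li eqxx (negPf ij) orbF => ->.
Qed.

Lemma basis_expansion (I : finType) (x : coordspace K I) :
  x = \sum_i (x i : K) *: basis_vec K i.
Proof.
apply/ffunP=> l; rewrite sum_ffunE (bigD1 l) //= big1 => [|k kl].
  by rewrite !ffunE eqxx addr0 [RHS]mulr1.
by rewrite !ffunE eq_sym (negPf kl) [LHS]mulr0.
Qed.

(** Turns membership in the even or odd part into the vanishing of coordinates. A spanning vector
    vanishes outside [P]; conversely, the basis expansion of [x] then only involves indices in
    [P]. *)
Lemma mem_span_basis (I : finType) (P : pred I) (x : coordspace K I) :
  (x \in <<[seq basis_vec K u | u in P]>>%VS) = [forall (u | ~~ P u), x u == 0].
Proof.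
apply/idP/forallP => [xP i|x0].
  apply/implyP=> Pi.
  rewrite (coord_span (X := in_tuple _) xP) sum_ffunE big1 // => h _.
  rewrite ffunE; have /imageP[k Pk ->] := mem_nth 0 (ltn_ord h).
  rewrite ffunE; case: eqP Pi => [->|_ _]; last by rewrite scaler0.
  by rewrite -topredE /= in Pk; rewrite Pk.
rewrite [x]basis_expansion; apply: memv_suml => i _.
have [Pi|Pi] := boolP (P i).
  by apply: memvZ; apply: memv_span; apply: image_f.
by have /implyP/(_ Pi)/eqP-> := x0 i; rewrite scale0r mem0v.
Qed.

(* The defining sum of the product is over triples of distinct elements; with
   [coef] vanishing on the diagonal the distinctness conditions can be
   dropped. *)
Lemma coef_gprod (d : decoration T) (s : T -> T -> T -> bool) a b j k :
    (forall t : triple T,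
       d (triple_block t) = s (val t).1.1 (val t).1.2 (val t).2) ->
    j != k ->
  coef (gprod d a b) [set j; k] =
  \sum_i ((-1) ^+ s i j k * (coef a [set i; j] * coef b [set i; k]) +
          (-1) ^+ s i k j * (coef a [set i; k] * coef b [set i; j])).
Proof.
move=> ds jk.
(* [F] makes sense for all triples, distinct or not; its last factor selects those whose product
   point is [{j, k}]. *)
pose F (u : T * T * T) : K :=
  (-1) ^+ s u.1.1 u.1.2 u.2 *
  (coef a [set u.1.1; u.1.2] * coef b [set u.1.1; u.2]) *
  ([set j; k] == [set u.1.2; u.2])%:R.
have -> : coef (gprod d a b) [set j; k] = \sum_(t : triple T) F (val t).
  rewrite (coef_pt _ jk) /gprod /basis_prod.
  under eq_bigr => p _ do under eq_bigr => q _ do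
    rewrite scaler_sumr big_mkcond.
  under eq_bigr => p _ do rewrite exchange_big /=.
  (* With the sum over triples outermost, a fixed [t] leaves only the pair [p = pt12 t],
     [q = pt13 t]. *)
  rewrite exchange_big /= sum_ffunE; apply: eq_bigr => t _.
  rewrite (bigD1 (pt12 t)) //= [X in _ + X]big1 ?addr0; last first.
    by move=> p /negPf pt; apply: big1 => q _; rewrite pt.
  rewrite (bigD1 (pt13 t)) //= [X in _ + X]big1 ?addr0; last first.
    by move=> q /negPf qt; rewrite qt andbF.
  rewrite !eqxx /= !ffunE /F ds.
  rewrite (coef_pt _ (triple_neq12 t)) (coef_pt _ (triple_neq13 t)).
  rewrite -[pt jk == _]val_eqE /=.
  by rewrite [LHS]mulrA; congr (_ * _); rewrite mulrC.
rewrite -(big_sub (fun u : T * T * T =>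
  [&& u.1.1 != u.1.2, u.1.1 != u.2 & u.1.2 != u.2])) big_mkcond /=.
(* Degenerate triples contribute 0: a repeated first entry gives a diagonal coefficient, and equal
   last entries give a singleton, which cannot be [{j, k}]. *)
have -> : \sum_(u : T * T * T) (if
    u \in (fun u : T * T * T =>
             [&& u.1.1 != u.1.2, u.1.1 != u.2 & u.1.2 != u.2])
    then F u else 0) = \sum_(u : T * T * T) F u.
  apply: eq_bigr => -[[i x] y] _; rewrite -topredE /F /=.
  have [->|] := eqVneq i x; first by rewrite coef_diag mul0r mulr0 mul0r.
  have [->|] := eqVneq i y; first by rewrite coef_diag !mulr0 mul0r.
  have [->|//] := eqVneq x y.
  have [e|_ _ _] := eqVneq [set j; k] [set y; y]; last by rewrite mulr0.
  by have := cards2 j k; rewrite e cards2 jk eqxx.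
rewrite -(pair_bigA _ (fun u y => F (u, y))) /=.
rewrite -(pair_bigA _ (fun i x => \sum_y F (i, x, y))) /=.
(* For a fixed common element [i], only the orderings [(j, k)] and [(k, j)] of the last two entries
   survive. *)
apply: eq_bigr => i _; rewrite (bigD1 j) //= [X in _ + X](bigD1 k) 1?eq_sym //=.
rewrite [X in _ + (_ + X)]big1 ?addr0; last first.
  move=> x /andP[/negPf xj /negPf xk]; apply: big1 => y _.
  by rewrite /F /= eq_sym eq_set2 // xj xk mulr0.
rewrite (bigD1 k) //= [X in _ + X + _]big1 ?addr0; last first.
  move=> y /negPf yk.
  by rewrite /F /= eq_sym eq_set2 // yk (negPf jk) andbF mulr0.
rewrite [X in _ + X](bigD1 j) //= [X in _ + (_ + X)]big1 ?addr0; last first.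
  move=> y /negPf yj.
  by rewrite /F /= eq_sym eq_set2 // yj ![k == j]eq_sym (negPf jk) andbF mulr0.
by rewrite /F /= [[set k; j]]setUC !eqxx !mulr1.
Qed.

End Coordinates.

(** * Identification of the trivially decorated algebra with symmetric zero-diagonal
    endomorphisms *)

Section MatrixAlgebra.
Variables (K : fieldType) (I : finType).
Notation U := (coordspace K I).
Notation A := (galg K I).
Notation S0 := (subvs_of (Sym0 K I)).
Implicit Types (a b : A) (x y : U) (i j k l : I).

Definition mxact a x : U := [ffun k => \sum_j coef a [set k; j] * x j].

Lemma mxact_linear a : linear (mxact a).
Proof.
move=> c x y; apply/ffunP=> k.
rewrite !ffunE /GRing.scale /= mulr_sumr -big_split.
by apply: eq_bigr => j _; rewrite !ffunE /GRing.scale /=; ring.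
Qed.

HB.instance Definition _ a :=
  GRing.isLinear.Build K U U *:%R (mxact a) (mxact_linear a).

Definition mxend a : 'End(U) := linfun (mxact a).

Lemma mxend_linear : linear mxend.
Proof.
move=> c a b; apply/lfunP=> x; rewrite add_lfunE scale_lfunE !lfunE /=.
apply/ffunP=> k.
rewrite !ffunE /GRing.scale /= mulr_sumr -big_split.
by apply: eq_bigr => j _; rewrite coef_lin /=; ring.
Qed.

HB.instance Definition _ :=
  GRing.isLinear.Build K A 'End(U) *:%R mxend mxend_linear.

Lemma mxendE a x k : mxend a x k = \sum_j coef a [set k; j] * x j.
Proof. by rewrite lfunE ffunE. Qed.

Lemma mxend_basisE a j k : mxend a (basis_vec K j) k = coef a [set k; j].
Proof.
rewrite mxendE (bigD1 j) //= big1 => [|i ij].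
  by rewrite ffunE eqxx mulr1 addr0.
by rewrite ffunE (negPf ij) mulr0.
Qed.

Lemma lfun_entries (X Y : 'End(U)) :
    (forall k l, X (basis_vec K l) k = Y (basis_vec K l) k :> K) -> X = Y.
Proof.
move=> XY; apply/lfunP=> x; rewrite [x]basis_expansion !linear_sum.
apply: eq_bigr => l _; rewrite !linearZ; congr (_ *: _).
by apply/ffunP=> k; apply: XY.
Qed.

(** Both endomorphisms have entry 1 at [(i, j)] and [(j, i)] and 0 elsewhere. *)
Lemma mxend_pt i j (ij : i != j) : mxend (basis_vec K (pt ij)) = symS K i j.
Proof.
apply: lfun_entries => k l; rewrite mxend_basisE add_lfunE ffunE !rank1_basis.
rewrite coef_basis eq_set2 // ![_ == l]eq_sym.
have [->|_] := eqVneq k i; last first.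
  by rewrite /= mulr0 add0r -mulnb natrM mulrC.
by rewrite (negPf ij) /= mulr0 addr0 orbF mulr1.
Qed.

Lemma mxend_Sym0 a : mxend a \in Sym0 K I.
Proof.
rewrite [a]basis_expansion linear_sum; apply: memv_suml => p _.
rewrite linearZ /= memvZ //; have [i [j [ij ->]]] := pointP p.
rewrite mxend_pt; apply: memv_span.
exact: (image_f (fun u : I * I => symS K u.1 u.2) (x := (i, j))).
Qed.

(** The image of [mxend] is a subspace, so it suffices that it contains the generators
    [symS K i j]. *)
Lemma Sym0_mxend (X : 'End(U)) : X \in Sym0 K I -> exists a, X = mxend a.
Proof.
suff /subvP S : (Sym0 K I <= limg (linfun mxend))%VS.
  by move=> /S /memv_imgP[a _ ->]; exists a; rewrite lfunE.
apply/span_subvP=> _ /imageP[[i j] ij ->] /=.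
by rewrite -(mxend_pt (ij : i != j)) -[mxend _]lfunE memv_img ?memvf.
Qed.

Definition sym0_iso : 'Hom(A, S0) := linfun (vsproj (Sym0 K I) \o mxend).

Lemma sym0_isoE a : vsval (sym0_iso a) = mxend a.
Proof. by rewrite lfunE /= vsprojK // mxend_Sym0. Qed.

Lemma sym0_iso_inj : injective sym0_iso.
Proof.
move=> a b /(congr1 vsval); rewrite !sym0_isoE => ab.
by apply: coef_inj => i j _; rewrite -!mxend_basisE ab.
Qed.

Lemma sym0_isoK : cancel sym0_iso (sym0_iso^-1)%VF.
Proof. by apply: lker0_lfunK; apply/lker0P/sym0_iso_inj. Qed.

Lemma sym0_iso_bij : bijective sym0_iso.
Proof.
exists (sym0_iso^-1)%VF; first exact: sym0_isoK.
move=> X; apply: limg_lfunVK; have [a Xa] := Sym0_mxend (valP X).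
suff -> : X = sym0_iso a by rewrite memv_img ?memvf.
by apply: val_inj; rewrite /= sym0_isoE.
Qed.

(** * The projection onto [Sym0] and the transported product *)

Lemma Diag_entries (X : 'End(U)) :
    (forall k l, k != l -> X (basis_vec K l) k = 0) -> X \in Diag K I.
Proof.
move=> X0.
have -> : X = \sum_i (X (basis_vec K i) i : K) *:
                 rank1 (basis_vec K i) (basis_vec K i).
  apply: lfun_entries => k l; rewrite sum_lfunE sum_ffunE (bigD1 k) //=.
  rewrite big1 => [|i /negPf ik]; rewrite scale_lfunE ffunE rank1_basis.
    have [->|kl] := eqVneq k l; first by rewrite addr0 eqxx !mulr1 [RHS]mulr1.
    by rewrite X0 // mul0r addr0 scaler0.
  by rewrite [k == i]eq_sym ik mulr0 scaler0.
by apply: memv_suml => i _; rewrite memvZ // memv_span // image_f.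
Qed.

(** [X - mxend a] is diagonal, so [X] lies in [Sym0 + Diag], where the projection is meaningful, and
    its [Sym0] component is [mxend a]. *)
Lemma to_Sym0_entries a (X : 'End(U)) :
    (forall k l, k != l -> X (basis_vec K l) k = coef a [set k; l]) ->
  to_Sym0 X = sym0_iso a.
Proof.
move=> Xa; have dis := Sym0_Diag_disjoint K I.
have D : X - mxend a \in Diag K I.
  apply: Diag_entries => k l kl.
  by rewrite add_lfunE opp_lfunE !ffunE mxend_basisE Xa // [LHS]subrr.
apply: val_inj; rewrite /= sym0_isoE /sym_proj.
rewrite -{1}[X](subrK (mxend a)) linearD /=.
rewrite (daddv_pi_id dis (mxend_Sym0 a)) -[RHS]add0r; congr (_ + _).
(* The projection kills [X - mxend a]: the two complementary projections of this element add up to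
   it, and the one onto [Diag] already fixes it. *)
have dis' : (Diag K I :&: Sym0 K I = 0)%VS by rewrite capvC.
apply: (addIr (X - mxend a)); rewrite add0r -{2}(daddv_pi_id dis' D).
by rewrite daddv_pi_add // (subvP (addvSr _ _)).
Qed.

Lemma rank1_basis_col x y k l : rank1 x y (basis_vec K l) k = y l * x k :> K.
Proof.
rewrite lfunE ffunE; congr (_ * _); rewrite /dotprod (bigD1 l) //= big1.
  by rewrite ffunE eqxx mulr1 addr0.
by move=> i il; rewrite ffunE (negPf il) mulr0.
Qed.

Lemma mxend_comp_basis a b k l :
  (mxend a \o mxend b)%VF (basis_vec K l) k =
  \sum_j coef a [set k; j] * coef b [set j; l] :> K.
Proof.
by rewrite comp_lfunE mxendE; apply: eq_bigr => j _; rewrite mxend_basisE.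
Qed.

(** Reduces the [Sym0] component, including the inverse of the identification, to a check of
    off-diagonal entries. The summation index comes first in each pair, to match [coef_gprod]. *)
Lemma transported_mprodE x y a b c :
    (forall k l, k != l -> coef c [set k; l] =
       \sum_j (coef a [set j; k] * coef b [set j; l] +
               coef a [set j; l] * coef b [set j; k])
       - x k * y l - x l * y k) ->
  transported_mprod sym0_iso (x, a) (y, b) = (- mxend a y - mxend b x, c).
Proof.
move=> cE; rewrite /transported_mprod /mprod /= !sym0_isoE; congr (_, _).
rewrite (@to_Sym0_entries c) ?sym0_isoK // => k l kl.
rewrite !(add_lfunE, opp_lfunE, ffunE) !rank1_basis_col !mxend_comp_basis.
rewrite cE // big_split /=; congr (_ + _ - _ - _); last exact: mulrC.
- by apply: eq_bigr => j _; rewrite coefC.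
- by apply: eq_bigr => j _; rewrite mulrC (coefC a) (coefC b).
Qed.

Lemma transported_mprod_even a b :
  transported_mprod sym0_iso (0, a) (0, b) =
  (0, gprod (@trivial_decoration I) a b).
Proof.
rewrite (@transported_mprodE _ _ _ _ (gprod (@trivial_decoration I) a b)).
  by rewrite !linear0 addr0.
move=> k l kl; rewrite (@coef_gprod _ _ _ (fun _ _ _ => false)) //.
rewrite !ffunE !mul0r !subr0.
by apply: eq_bigr => j _; rewrite !mul1r.
Qed.

Lemma transported_mprod_act a x :
  transported_mprod sym0_iso (0, a) (x, 0) = (- vsval (sym0_iso a) x, 0).
Proof.
rewrite (@transported_mprodE _ _ _ _ 0).
  by rewrite !linear0 addr0 sym0_isoE.
have c0 S : coef (0 : A) S = 0.
  by rewrite /coef; case: insub => //= p; rewrite ffunE.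
move=> k l _; rewrite c0 big1 => [|j _]; last by rewrite !c0 !mulr0 addr0.
by rewrite !ffunE !mul0r !subr0.
Qed.

End MatrixAlgebra.

(** * Splitting off the row of [w] in the star-decorated algebra *)

Section StarDecoration.
Variables (K : fieldType) (T : finType) (w : T).
Notation I := (punctured w).
Notation U := (coordspace K I).
Notation A := (galg K I).
Implicit Types (a b : galg K T) (i j : I).

Definition star_split a : U * A :=
  ([ffun i : I => coef a [set w; val i] : K^o],
   [ffun p : point I => coef a (val @: val p) : K^o]).

Lemma star_split_linear : linear star_split.
Proof.
by move=> c a b; congr (_, _); apply/ffunP=> p; rewrite !ffunE coef_lin.
Qed.

HB.instance Definition _ :=
  GRing.isLinear.Build K (galg K T) (U * A)%type *:%R
    star_split star_split_linear.

Lemma star_split2E a i j :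
  coef (star_split a).2 [set i; j] = coef a [set val i; val j].
Proof.
have [->|ij] := eqVneq i j; first by rewrite !coef_diag.
by rewrite (coef_pt _ ij) ffunE imsetU1 imset_set1.
Qed.

(** Inverse of [star_split]. For a point [p] containing [w] the sum has exactly one term, which
    avoids choosing the other element of [p]. *)
Definition star_glue (u : U * A) : galg K T :=
  [ffun p : point T =>
     (if w \in val p then \sum_(i : I | val i \in val p) (u.1 i : K)
      else coef u.2 (val @^-1: val p)) : K^o].

Lemma star_glue1E (u : U * A) i : coef (star_glue u) [set w; val i] = u.1 i.
Proof.
have wi : w != val i by rewrite eq_sym (valP i).
rewrite (coef_pt _ wi) /star_glue ffunE /= set21.
rewrite (bigD1 i) ?set22 //= big1 ?addr0 //.
move=> j /andP[]; rewrite !inE (negPf (valP j)) /= => /eqP/val_inj->.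
by rewrite eqxx.
Qed.

Lemma star_glue2E (u : U * A) i j :
  coef (star_glue u) [set val i; val j] = coef u.2 [set i; j].
Proof.
have [->|ij] := eqVneq i j; first by rewrite !coef_diag.
have vij : val i != val j by [].
rewrite (coef_pt _ vij) /star_glue ffunE /= !inE ![w == _]eq_sym.
rewrite (negPf (valP i)) (negPf (valP j)) /=; congr (coef _ _).
by apply/setP=> k; rewrite !inE.
Qed.

Lemma punctureP (x : T) : x = w \/ exists i : I, x = val i.
Proof.
by have [->|xw] := eqVneq x w; [left | right; exists (Sub x xw); rewrite SubK].
Qed.

Lemma coef_inj_at a b :
    (forall i, coef a [set w; val i] = coef b [set w; val i]) ->
    (forall i j, coef a [set val i; val j] = coef b [set val i; val j]) ->
  a = b.
Proof.
move=> ab1 ab2; apply: coef_inj => x y.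
have [->|[i ->]] := punctureP x; have [->|[j ->]] := punctureP y => // xy.
- by rewrite !coef_diag.
by rewrite ![coef _ [set _; w]]coefC.
Qed.

Lemma star_splitK : cancel star_split star_glue.
Proof.
move=> a; apply: coef_inj_at => [i|i j].
  by rewrite star_glue1E ffunE.
by rewrite star_glue2E star_split2E.
Qed.

Lemma star_glueK : cancel star_glue star_split.
Proof.
move=> [x b]; rewrite [LHS]surjective_pairing; congr (_, _).
  by apply/ffunP=> i; rewrite ffunE star_glue1E.
by apply: coef_inj => i j _; rewrite star_split2E star_glue2E.
Qed.

Lemma star_decoration_triple (t : triple T) :
  star_decoration w (triple_block t) =
  [|| w == (val t).1.1, w == (val t).1.2 | w == (val t).2].
Proof. by rewrite /star_decoration supp_triple_block !inE orbA. Qed.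

Lemma sum_puncture (F : T -> K) : \sum_x F x = F w + \sum_(i : I) F (val i).
Proof.
by rewrite (bigD1 w) //= -(big_sub (fun x => x != w)).
Qed.

(** The sum over middle indices is split at [w] and compared entrywise with the matrix product. *)
Lemma star_split_mul a b :
  star_split (gprod (star_decoration w) a b) =
  transported_mprod (sym0_iso K I) (star_split a) (star_split b).
Proof.
pose s x y z := [|| w == x, w == y | w == z].
have gE x y : x != y -> coef (gprod (star_decoration w) a b) [set x; y] =
    \sum_i ((-1) ^+ s i x y * (coef a [set i; x] * coef b [set i; y]) +
            (-1) ^+ s i y x * (coef a [set i; y] * coef b [set i; x])).
  exact/coef_gprod/star_decoration_triple.
have wF i : (w == val i) = false by rewrite eq_sym (negPf (valP i)).
rewrite [star_split a]surjective_pairing [star_split b]surjective_pairing.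
set g := gprod _ a b.
rewrite (@transported_mprodE _ _ _ _ _ _ (star_split g).2).
  rewrite [LHS]surjective_pairing; congr (_, _); apply/ffunP=> i.
  (* Entry [{w, i}]: the middle index [w] gives only diagonal coefficients, hence 0, and every other
     triple contains [w], hence has sign -1. This yields [-Xy - Yx]. *)
  rewrite [LHS]ffunE gE; last by rewrite wF.
  rewrite sum_puncture !coef_diag mul0r !mulr0 addr0 add0r.
  rewrite !(ffunE, add_lfunE, opp_lfunE, mxendE) /= big_split /= addrC -!sumrN.
  congr (_ + _); apply: eq_bigr => j _;
    rewrite /s !wF eqxx ?orbT /= expr1 mulN1r star_split2E ffunE;
    rewrite ![coef _ [set val j; _]]coefC //.
  by rewrite mulrC.
(* Entry [{k, l}] away from [w]: middle indices other than [w] have sign +1 and give [XY + YX]; the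
   middle index [w] has sign -1 and gives the rank-one terms. *)
move=> k l kl; rewrite !star_split2E gE // sum_puncture addrC -addrA.
congr (_ + _).
  apply: eq_bigr => j _; rewrite /s !wF /= !mul1r.
  by rewrite !star_split2E.
by rewrite /s eqxx /= expr1 !mulN1r !ffunE.
Qed.

(** * The grading attached to [{w}] *)

Lemma odd_meet_set1 (p : {set T}) : odd #|(p :&: [set w])%SET| = (w \in p).
Proof.
have [wp|wp] := boolP (w \in p); first by rewrite (setIidPr _) ?sub1set ?cards1.
suff -> : (p :&: [set w])%SET = set0 by rewrite cards0.
by apply/setP=> x; rewrite !inE andbC; case: eqP => // ->; rewrite (negPf wp).
Qed.

(** The even points are those avoiding [w], and the coefficients there are exactly the coordinates
    of the second component. *)
Lemma odd_part_star a : (a \in odd_part K [set w]) = ((star_split a).2 == 0).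
Proof.
rewrite mem_span_basis; apply/forallP/eqP => [a0|a0 p].
  apply/ffunP=> p; rewrite !ffunE; have [i [j [ij ->]]] := pointP p.
  have vij : val i != val j by [].
  rewrite imsetU1 imset_set1 (coef_pt _ vij).
  apply/eqP; apply: (implyP (a0 _)); rewrite /= odd_meet_set1 !inE negb_or.
  by rewrite ![w == _]eq_sym (valP i) (valP j).
apply/implyP; rewrite /= odd_meet_set1; have [x [y [xy ->]]] := pointP p.
rewrite -coef_pt !inE negb_or.
have [->|[i ->]] := punctureP x; first by rewrite eqxx.
have [->|[j ->]] := punctureP y; first by rewrite eqxx andbF.
rewrite -star_split2E a0 /coef; case: insub => //= q.
by rewrite ffunE eqxx.
Qed.

(** Dually, the odd points are the pairs [{w, i}], whose coefficients form the first component. *)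
Lemma even_part_star a : (a \in even_part K [set w]) = ((star_split a).1 == 0).
Proof.
rewrite mem_span_basis; apply/forallP/eqP => [a0|a0 p].
  apply/ffunP=> i; rewrite !ffunE.
  have wi : w != val i by rewrite eq_sym (valP i).
  rewrite (coef_pt _ wi); apply/eqP; apply: (implyP (a0 _)).
  by rewrite /= odd_meet_set1 negbK set21.
apply/implyP; rewrite /= odd_meet_set1 negbK; have [x [y [xy ->]]] := pointP p.
rewrite -coef_pt /=.
have a0' i : coef a [set w; val i] = 0 by move/ffunP/(_ i): a0; rewrite !ffunE.
have [xw|[i ->]] := punctureP x; have [yw|[j ->]] := punctureP y.
- by rewrite xw yw eqxx in xy.
- by rewrite xw a0'.
- by rewrite yw coefC a0'.
by rewrite !inE ![w == _]eq_sym (negPf (valP i)) (negPf (valP j)).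
Qed.

End StarDecoration.

Theorem corollary3p4 (K : fieldType) (m : nat) (w : 'I_m) :
  formally_real K -> pythagorean K -> (3 <= m)%N ->
  exists sigma : 'Hom(galg K (punctured w), subvs_of (Sym0 K (punctured w))),
  [/\ bijective sigma,
      forall (i j : punctured w) (ij : i != j),
        vsval (sigma (basis_vec K (pt ij))) = symS K i j
    & exists phi : 'Hom(galg K 'I_m,
                        (coordspace K (punctured w) *
                         galg K (punctured w))%type),
      [/\ algebra_iso (gprod (star_decoration w)) (transported_mprod sigma)
            phi,
          forall a, (a \in odd_part K [set w]) = ((phi a).2 == 0),
          forall a, (a \in even_part K [set w]) = ((phi a).1 == 0),
          forall a b : galg K (punctured w),
            transported_mprod sigma (0, a) (0, b) =
            (0, gprod (@trivial_decoration (punctured w)) a b)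
        & forall (a : galg K (punctured w))
                 (x : coordspace K (punctured w)),
            transported_mprod sigma (0, a) (x, 0) =
            (- vsval (sigma a) x, 0)]].
Proof.
move=> _ _ _; exists (sym0_iso K (punctured w)); split.
- exact: sym0_iso_bij.
- by move=> i j ij; rewrite sym0_isoE mxend_pt.
exists (linfun (@star_split K _ w)); split.
- split=> [|a b]; last by rewrite !lfunE; apply: star_split_mul.
  exists (@star_glue K _ w) => u; first by rewrite lfunE; apply: star_splitK.
  by rewrite lfunE; apply: star_glueK.
- by move=> a; rewrite lfunE; apply: odd_part_star.
- by move=> a; rewrite lfunE; apply: even_part_star.
- exact: transported_mprod_even.
exact: transported_mprod_act.
Qed.
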